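(* Let $G$ be a finite abelian group with the weak Rédei property. If every proper subgroup of $G$ has the UPT property, then $G$ has the PT property.
   Context: For a finite abelian group $G$ (written additively), a pair $(\Omega,T)$ of subsets of $G$ is a tiling pair if every $g\in G$ can be written uniquely as $g=\omega+t$ with $\omega\in\Omega$, $t\in T$; then $\Omega$ is called a tile and $T$ a tiling complement of $\Omega$. $\mathcal{T}_\Omega$ denotes the set of all tiling complements of a tile $\Omega$. A nonempty subset $A\subset G$ is periodic if there is a nonzero $g\in G$ with $A+g=A$. $G$ has the PT property if for every tiling pair $(\Omega,T)$ of $G$, either $\Omega$ is periodic, or there is a periodic set $T'\subset G$ such that $(\Omega,T')$ is also a tiling pair. A tile $\Omega$ is uniformly periodic if there is $g\in G\setminus\{0\}$ with $T+g=T$ for every $T\in\mathcal{T}_\Omega$; it is dual uniformly periodic if there is a periodic tile $\Omega'$ such that $(\Omega',T)$ is a tiling pair for each $T\in\mathcal{T}_\Omega$. $G$ has the UPT property if every tile in $G$ is either uniformly periodic or dual uniformly periodic. $G$ has the weak Rédei property if for every tile $\Omega$ of $G$ with $0\in\Omega$ and $\langle\Omega\rangle=G$ (where $\langle\Omega\rangle$ is the subgroup generated by $\Omega$), there exists a tiling complement $T$ of $\Omega$ contained in a proper subgroup of $G$. Convention: the trivial group is regarded as having the PT and UPT properties. *)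

(* Defs.v *)
(* Finite abelian groups are taken as groups G : {group gT},
   written multiplicatively: 1 stands for 0, w * t for w + t and A :* g for
   A + g. All notions are relative to G, so that they apply to its subgroups
   (whose tiles and tiling complements are subsets of the subgroup). *)
From mathcomp Require Import all_boot all_fingroup.

Set Implicit Arguments.
Unset Strict Implicit.
Unset Printing Implicit Defensive.

Local Open Scope group_scope.

Definition tiling_pair (gT : finGroupType) (G : {group gT})
    (Omega T : {set gT}) : Prop :=
  [/\ Omega \subset G,
      T \subset G &
      forall g, g \in G ->
        exists! p : gT * gT,
          [/\ p.1 \in Omega, p.2 \in T & g = p.1 * p.2]].

Definition tile (gT : finGroupType) (G : {group gT})
    (Omega : {set gT}) : Prop :=
  exists T : {set gT}, tiling_pair G Omega T.

Definition periodic (gT : finGroupType) (G : {group gT})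
    (A : {set gT}) : Prop :=
  [/\ A \subset G,
      A != set0 &
      exists g : gT, [/\ g \in G, g != 1 & A :* g = A]].

(* The trivial group is declared to have the PT and UPT properties; neither
   holds for it without the first disjunct. *)
Definition PT_property (gT : finGroupType) (G : {group gT}) : Prop :=
  G :=: 1 \/
  forall Omega T : {set gT}, tiling_pair G Omega T ->
    periodic G Omega \/
    exists T' : {set gT}, periodic G T' /\ tiling_pair G Omega T'.

Definition uniformly_periodic (gT : finGroupType) (G : {group gT})
    (Omega : {set gT}) : Prop :=
  exists g : gT,
    [/\ g \in G, g != 1 &
        forall T : {set gT}, tiling_pair G Omega T -> T :* g = T].

Definition dual_uniformly_periodic (gT : finGroupType) (G : {group gT})
    (Omega : {set gT}) : Prop :=
  exists Omega' : {set gT},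
    [/\ periodic G Omega', tile G Omega' &
        forall T : {set gT}, tiling_pair G Omega T -> tiling_pair G Omega' T].

Definition UPT_property (gT : finGroupType) (G : {group gT}) : Prop :=
  G :=: 1 \/
  forall Omega : {set gT}, tile G Omega ->
    uniformly_periodic G Omega \/ dual_uniformly_periodic G Omega.

Definition weak_Redei_property (gT : finGroupType) (G : {group gT}) : Prop :=
  forall Omega : {set gT},
    tile G Omega -> 1 \in Omega -> <<Omega>> = G ->
    exists T : {set gT}, exists H : {group gT},
      [/\ tiling_pair G Omega T, H \proper G & T \subset H].

(* Main.v *)
(* Let (Omega, T) be a tiling pair of G with 1 in Omega.  If T lies in a
   subgroup H, then every slice H :&: (Omega :* g^-1) is a complement of T in H.
   So if T is uniformly periodic in H, all the slices, hence Omega, share a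
   period; and if T is dual uniformly periodic, the corresponding periodic set
   is a complement of every slice, hence of Omega.
   If Omega generates G, the weak Redei property provides such a T with H
   proper.  If Omega generates a proper subgroup K, the same argument inside K
   (with H = K) shows that Omega is periodic or has a periodic complement in K,
   and translates of the latter along a transversal of K form a periodic
   complement in G. *)
Require Import Defs.
From mathcomp Require Import all_boot all_fingroup.

Set Implicit Arguments.
Unset Strict Implicit.
Unset Printing Implicit Defensive.

Local Open Scope group_scope.

Lemma rcoset_stabP (gT : finGroupType) (A : {set gT}) (g : gT) :
  A :* g = A <-> forall x, (x * g \in A) = (x \in A).
Proof.
split=> [Ag x | Ag]; first by rewrite -{1}Ag mem_rcoset mulgK.
by apply/setP=> x; rewrite mem_rcoset -Ag mulgKV.
Qed.

(** The factor in [T] determines the one in [Omega] as [g * t^-1], so uniqueness of the pair reduces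
    to uniqueness of [t]. *)
Lemma tiling_pairP (gT : finGroupType) (G : {group gT}) (Omega T : {set gT}) :
  tiling_pair G Omega T <->
  [/\ Omega \subset G, T \subset G &
      forall g, g \in G -> exists! t, t \in T /\ g * t^-1 \in Omega].
Proof.
split=> -[sOG sTG tile_g]; split=> // g /tile_g.
  case=> -[w t] [/= [Ow Tt ->] uniq_wt]; exists t; split; first by rewrite mulgK.
  move=> t' [Tt' Ow']; have /= := uniq_wt (w * t * t'^-1, t').
  by rewrite mulgKV => /(_ (And3 Ow' Tt' erefl)) [].
case=> t [[Tt Ogt] uniq_t]; exists (g * t^-1, t); split=> [|[w t'] /=].
  by split; rewrite //= mulgKV.
case=> Ow Tt' Dg; have <-: t = t' by apply: uniq_t; rewrite Dg mulgK.
rewrite Dg in uniq_t *; rewrite (uniq_t t') ?mulgK //.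
Qed.

Lemma tiling_pair_neq0 (gT : finGroupType) (G : {group gT})
    (Omega T : {set gT}) :
  tiling_pair G Omega T -> Omega != set0.
Proof.
by case=> _ _ /(_ 1 (group1 G)) [[w t] [[/= Ow _ _] _]]; apply/set0Pn; exists w.
Qed.

Lemma periodicS (gT : finGroupType) (G H : {group gT}) (A : {set gT}) :
  H \subset G -> periodic H A -> periodic G A.
Proof.
move=> sHG [sAH nzA [g [Hg nt_g Ag]]].
split=> //; first exact: subset_trans sHG.
by exists g; rewrite (subsetP sHG).
Qed.

Lemma periodic_group (gT : finGroupType) (G : {group gT}) :
  G :!=: 1 -> periodic G G.
Proof.
case/trivgPn=> g Gg nt_g; split=> //; first by apply/set0Pn; exists 1.
by exists g; rewrite rcoset_id.
Qed.

Lemma tiling_pairC (gT : finGroupType) (G : {group gT}) (Omega T : {set gT}) :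
  abelian G -> tiling_pair G Omega T -> tiling_pair G T Omega.
Proof.
move=> abG [sOG sTG tile_g]; split=> // g /tile_g [[w t] [/= [Ow Tt ->] uniq_wt]].
have C x y : x \in Omega -> y \in T -> x * y = y * x.
  by move=> Ox Ty; rewrite (centsP abG _ (subsetP sOG _ Ox)) ?(subsetP sTG).
exists (t, w); split=> [|[t' w'] /= [Tt' Ow' Dg]]; first by rewrite /= C.
have eq_wt: (w, t) = (w', t') by apply: uniq_wt; rewrite /= Dg (C w').
by case: eq_wt => -> ->.
Qed.

Section Abelian.

Variables (gT : finGroupType) (G : {group gT}).
Hypothesis abG : abelian G.

Let mulCG x y : x \in G -> y \in G -> x * y = y * x.
Proof. by move=> Gx Gy; apply: (centsP abG). Qed.

Lemma tiling_pair_rcoset (Omega T : {set gT}) (a : gT) :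
  a \in G -> tiling_pair G Omega T -> tiling_pair G (Omega :* a) T.
Proof.
move=> Ga /tiling_pairP [sOG sTG tile_g]; apply/tiling_pairP; split=> //.
  by rewrite -(rcoset_id Ga) mulSg.
move=> g Gg; have [|t [[Tt Ot] uniq_t]] := tile_g (g * a^-1).
  by rewrite groupM ?groupV.
have E x : x \in T -> (g * x^-1 \in Omega :* a) = (g * a^-1 * x^-1 \in Omega).
  move=> Tx; rewrite mem_rcoset -!mulgA [x^-1 * _]mulCG ?groupV //.
  exact: (subsetP sTG).
exists t; split=> [|t' [Tt']]; first by rewrite E.
by rewrite E // => Ot'; apply: uniq_t.
Qed.

Lemma periodic_rcoset (A : {set gT}) (a : gT) :
  a \in G -> periodic G A -> periodic G (A :* a).
Proof.
move=> Ga [sAG /set0Pn[x Ax] [g [Gg nt_g Ag]]]; split.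
- by rewrite -(rcoset_id Ga) mulSg.
- by apply/set0Pn; exists (x * a); rewrite mem_rcoset mulgK.
by exists g; split=> //; rewrite -rcosetM mulCG // rcosetM Ag.
Qed.

Definition slice (H : {group gT}) (Omega : {set gT}) (g : gT) : {set gT} :=
  [set x in H | x * g \in Omega].

(** For [t] in [T], commutativity gives [h * g * t^-1 = (h * t^-1) * g], and [h * t^-1] stays in
    [H]: factoring [h * g] through [Omega] is factoring [h] through the slice at [g]. Conversely,
    the case [h = 1] of all slices recovers every [g]. *)
Lemma tiling_pair_slice (H : {group gT}) (Omega T : {set gT}) :
    Omega \subset G -> H \subset G -> T \subset H ->
  tiling_pair G Omega T <->
  (forall g, g \in G -> tiling_pair H (slice H Omega g) T).
Proof.
move=> sOG sHG sTH; have sTG := subset_trans sTH sHG.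
have VG t : t \in T -> t^-1 \in G by move/(subsetP sTG); rewrite groupV.
split=> [/tiling_pairP[_ _ tile_g] g Gg | tile_s]; apply/tiling_pairP.
  split=> // [|h Hh]; first by apply/subsetP=> x /setIdP[].
  have [|t [[Tt Ot] uniq_t]] := tile_g (h * g).
    by rewrite groupM // (subsetP sHG).
  have E x : x \in T -> (h * x^-1 \in slice H Omega g) = (h * g * x^-1 \in Omega).
    move=> Tx; rewrite inE (groupMl _ Hh) groupV (subsetP sTH) //=.
    by rewrite -!mulgA [x^-1 * g]mulCG ?VG.
  exists t; split=> [|t' [Tt']]; first by rewrite E.
  by rewrite E // => Ot'; apply: uniq_t.
split=> // g Gg; have /tiling_pairP[_ _ /(_ 1 (group1 H))] := tile_s g Gg.
have E x : x \in T -> (1 * x^-1 \in slice H Omega g) = (g * x^-1 \in Omega).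
  move=> Tx; rewrite mul1g inE groupV (subsetP sTH) //=.
  by rewrite [x^-1 * g]mulCG ?VG.
case=> t [[Tt Ot] uniq_t]; exists t; split=> [|t' [Tt']]; first by rewrite -E.
by rewrite -E // => Ot'; apply: uniq_t.
Qed.

Lemma UPT_periodic (H : {group gT}) (Omega T : {set gT}) :
    G :!=: 1 -> H \subset G -> UPT_property H -> T \subset H ->
    tiling_pair G Omega T ->
  periodic G Omega \/ exists T', periodic G T' /\ tiling_pair G Omega T'.
Proof.
move=> ntG sHG uptH sTH tileOT; have [sOG _ _] := tileOT.
have tile_s := (tiling_pair_slice sOG sHG sTH).1 tileOT.
have abH : abelian H := abelianS sHG abG.
(* By convention the UPT property says nothing about trivial [H]; but then [T] contains only [1],
   which forces [Omega = G]. *)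
have [H1 | ntH] := eqVneq (H : {set gT}) 1.
  left; suff ->: Omega = G by apply: periodic_group.
  apply/eqP; rewrite eqEsubset sOG; apply/subsetP=> g Gg.
  have /tiling_pairP[_ _ /(_ g Gg)[t [[Tt]]]] := tileOT.
  by have /subsetP/(_ t Tt) := sTH; rewrite H1 inE => /eqP->; rewrite invg1 mulg1.
case: uptH => [H1 | uptH]; first by rewrite H1 eqxx in ntH.
(* The UPT property is applied to [T], a tile of [H] since the slice at [1] complements it; its
   complements include all slices of [Omega]. *)
have [|[h [Hh nt_h per_h]] | [T' [perT' [T'' tileT'] tile_sT']]] := uptH T.
- by exists (slice H Omega 1); apply: tiling_pairC (tile_s 1 _).
- left; split=> //; first exact: tiling_pair_neq0 tileOT.
  have Gh := subsetP sHG h Hh; exists h; split=> //; apply/rcoset_stabP=> x.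
  have [Gx | notGx] := boolP (x \in G); last first.
    by rewrite !(contraNF (subsetP sOG _)) // groupMr.
  (* [x] and [x * h] lie in [Omega] exactly when [1] and [h] lie in the slice at [x], which has
     period [h]. *)
  have /rcoset_stabP/(_ 1) := per_h _ (tiling_pairC abH (tile_s x Gx)).
  by rewrite !inE !mul1g Hh group1 /= mulCG.
right; exists T'; split; first exact: periodicS perT'.
have [sT'H _ _] := tileT'; apply/(tiling_pair_slice sOG sHG sT'H) => g Gg.
by apply: tiling_pairC => //; apply/tile_sT'/tiling_pairC=> //; apply: tile_s.
Qed.

(** If [h] and [h * t^-1] are both in [H], so is [t]: factoring an element of [H] only involves
    [T :&: H]. *)
Lemma tiling_pair_setI (H : {group gT}) (Omega T : {set gT}) :
  H \subset G -> Omega \subset H ->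
  tiling_pair G Omega T -> tiling_pair H Omega (T :&: H).
Proof.
move=> sHG sOH /tiling_pairP[_ _ tile_g]; apply/tiling_pairP.
split=> // [|h Hh]; first exact: subsetIr.
have [t [[Tt Ot] uniq_t]] := tile_g h (subsetP sHG h Hh).
exists t; split=> [|t' [/setIP[Tt' _] Ot']]; last exact: uniq_t.
split=> //; rewrite inE Tt -groupV -(groupMl _ Hh).
exact: (subsetP sOH).
Qed.

(* The product of T and the transversal of H formed by the chosen coset
   representatives. *)
Definition coset_lift (H : {group gT}) (T : {set gT}) : {set gT} :=
  [set t in G | t * (repr (H :* t))^-1 \in T].

(** Since [Omega] lies in [H], a factor [x] of [g] lies in the coset of [g] and shares its
    representative [r]. Factoring [g] with [x] thus amounts to factoring [g * r^-1] in [H] with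
    [x * r^-1]. *)
Lemma tiling_pair_coset_lift (H : {group gT}) (Omega T : {set gT}) :
  H \subset G -> tiling_pair H Omega T ->
  tiling_pair G Omega (coset_lift H T).
Proof.
move=> sHG /tiling_pairP[sOH sTH tile_h]; apply/tiling_pairP.
split=> [||g Gg]; first exact: subset_trans sHG.
  by apply/subsetP=> x; rewrite inE => /andP[].
set r := repr (H :* g); have Hgr : g * r^-1 \in H.
  by rewrite -mem_rcoset rcoset_sym /r mem_repr_rcoset.
have Gr : r \in G.
  by rewrite -groupV -(groupMl _ Gg) (subsetP sHG).
have [t [[Tt Ot] uniq_t]] := tile_h _ Hgr.
have Gt := subsetP sHG t (subsetP sTH t Tt).
have rE x : x \in G -> g * x^-1 \in H -> repr (H :* x) = r.
  by move=> Gx; rewrite -mem_rcoset => /rcoset_eqP<-.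
have E x : x \in G -> g * r^-1 * (x * r^-1)^-1 = g * x^-1.
  by move=> Gx; rewrite invMg invgK mulgA mulgKV.
exists (t * r); split.
  have Etr : g * (t * r)^-1 = g * r^-1 * t^-1 by rewrite invMg mulgA.
  have Htr : g * (t * r)^-1 \in H by rewrite Etr (subsetP sOH).
  have Gtr : t * r \in G by rewrite groupM.
  by rewrite Etr inE Gtr (rE _ Gtr Htr) mulgK.
move=> x [/setIdP[Gx Tx] Ox]; rewrite rE // in Tx; last exact: (subsetP sOH).
by rewrite (uniq_t (x * r^-1)) ?mulgKV // E.
Qed.

(** Multiplying by a period [h] in [H] keeps the coset, hence its representative, so [h] remains a
    period. *)
Lemma periodic_coset_lift (H : {group gT}) (T : {set gT}) :
  H \subset G -> periodic H T -> periodic G (coset_lift H T).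
Proof.
move=> sHG [sTH /set0Pn[t Tt] [h [Hh nt_h /rcoset_stabP Th]]].
have Gh := subsetP sHG h Hh.
have sLG : coset_lift H T \subset G.
  by apply/subsetP=> x /setIdP[].
have rG x : x \in G -> repr (H :* x) \in G.
  move=> Gx; have := mem_repr_rcoset H x.
  by rewrite mem_rcoset => /(subsetP sHG); rewrite groupMr ?groupV.
have rM k x : k \in H -> repr (H :* (k * x)) = repr (H :* x).
  by move=> Hk; rewrite rcosetM rcoset_id.
split=> //.
  have Hrr : repr H \in H by exact: mem_repr (group1 H).
  have Ht := subsetP sTH t Tt.
  apply/set0Pn; exists (t * repr H).
  by rewrite inE groupM ?(subsetP sHG) //= rcoset_id ?groupM // mulgK.
exists h; split=> //; apply/rcoset_stabP=> x.
rewrite !inE groupMr //; have [Gx /= | //] := boolP (x \in G).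
rewrite [x * h]mulCG // rM // [h * x]mulCG // -mulgA.
by rewrite [h * _]mulCG ?groupV ?rG // mulgA Th.
Qed.

End Abelian.

Theorem theorem1p5 (gT : finGroupType) (G : {group gT})
    (abG : abelian G)
    (redeiG : weak_Redei_property G)
    (uptG : forall H : {group gT}, H \proper G -> UPT_property H) :
  PT_property G.
Proof.
have [G1 | ntG] := eqVneq (G : {set gT}) 1; first by left.
right=> Omega0 T0 tile0.
have /set0Pn[a O0a] := tiling_pair_neq0 tile0.
have Ga : a \in G by case: tile0 => /subsetP/(_ a O0a).
have Gva : a^-1 \in G by rewrite groupV.
(* Translating puts [1] in the tile, as the weak Redei property requires, and affects neither its
   complements nor its periodicity. *)
pose Omega := Omega0 :* a^-1.
have O1 : 1 \in Omega by rewrite mem_rcoset invgK mul1g.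
have tileOT : tiling_pair G Omega T0 by exact: tiling_pair_rcoset.
suff [perO | [T' [perT' tileT']]] : periodic G Omega \/
    exists T', periodic G T' /\ tiling_pair G Omega T'.
- by left; rewrite -(rcosetKV a Omega0); apply: periodic_rcoset.
- right; exists T'; split=> //.
  by rewrite -(rcosetKV a Omega0); apply: tiling_pair_rcoset.
have sOG : Omega \subset G by case: tileOT.
have [genO | nKG] := eqVneq <<Omega>> (G : {set gT}).
  have [|T [H [tileT prH sTH]]] := redeiG Omega _ O1 genO; first by exists T0.
  exact: UPT_periodic (proper_sub prH) (uptG _ prH) sTH tileT.
pose K := <<Omega>>%G.
have prK : K \proper G by rewrite properEneq nKG gen_subG.
have sKG := proper_sub prK; have abK := abelianS sKG abG.
have tileK := tiling_pair_setI sKG (subset_gen Omega) tileOT.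
(* A trivial [K] means that [Omega] is [1] alone, whose complement [G] is periodic; [UPT_periodic]
   needs a nontrivial ambient group. *)
have [K1 | ntK] := eqVneq (K : {set gT}) 1.
  right; exists G; split; first exact: periodic_group.
  have DO : Omega = 1.
    by apply/eqP; rewrite eqEsubset sub1set O1 andbT -K1 subset_gen.
  apply/tiling_pairP; split=> // g Gg; exists g.
  split=> [|t [_]]; first by rewrite mulgV.
  by rewrite DO inE -eq_mulgV1 => /eqP.
have [perO | [T [perT tileT]]] :=
    UPT_periodic abK ntK (subxx K) (uptG K prK) (subsetIr T0 K) tileK.
  by left; apply: periodicS perO.
right; exists (coset_lift G K T).
by split; [apply: periodic_coset_lift | apply: tiling_pair_coset_lift].
Qed.
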